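(* For all $d\ge 1$ and $k\ge d+3$, the space $\mathfrak p_d^k$ of projective shapes containing a frame is not Hausdorff. In particular, the space $\mathfrak f_d^k\supseteq\mathfrak p_d^k$ of free projective shapes is not Hausdorff.
   Context: $\mathbb{RP}^d$ is the space of lines through the origin in $\mathbb R^{d+1}$. The group $\mathrm{PGL}(d):=\mathrm{GL}(d+1,\mathbb R)/\mathbb R^*$ acts component-wise on $A_d^k=(\mathbb{RP}^d)^k$, and $\mathfrak a_d^k=A_d^k/\mathrm{PGL}(d)$ carries the quotient topology; its elements are called shapes. A (projective) frame is a $(d+2)$-tuple of points of $\mathbb{RP}^d$ in general position, i.e. any $d+1$ of them span $\mathbb{RP}^d$. $\mathfrak p_d^k\subseteq\mathfrak a_d^k$ is the set of shapes of configurations $p\in A_d^k$ such that some $d+2$ of the landmarks $p_1,\dots,p_k$ form a frame. $\mathfrak f_d^k\subseteq\mathfrak a_d^k$ is the set of shapes of free configurations, i.e. those $p$ with trivial isotropy group $\{g\in\mathrm{PGL}(d): gp=p\}$. Both carry the subspace topology from $\mathfrak a_d^k$. *)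

(* Defs.v *)
From HB Require Import structures.
From mathcomp Require Import all_boot all_order all_algebra.
From mathcomp Require Import all_classical all_reals.
From mathcomp Require Import topology normedtype.

Set Implicit Arguments.
Unset Strict Implicit.
Unset Printing Implicit Defensive.

Import Order.TTheory GRing.Theory Num.Theory.
Import numFieldNormedType.Exports.

Local Open Scope classical_set_scope.
Local Open Scope ring_scope.
Local Open Scope quotient_scope.

Section ProjectiveSpace.
Variables (R : realType) (d : nat).

Definition nzvec : Type := set_type [set v : 'cV[R]_d.+1 | v != 0].
HB.instance Definition _ := Topological.on nzvec.

Definition line : Type := {L : {vspace 'cV[R]_d.+1} | \dim L == 1%N}.
HB.instance Definition _ := SubChoice.on line.

Fact dim_span_nzvec (v : nzvec) : \dim <[sval v]>%VS == 1%N.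
Proof. by case: v => v /= /set_mem v0; rewrite dim_vline v0. Qed.

Definition line_span (v : nzvec) : line := Sub <[sval v]>%VS (dim_span_nzvec v).

Fact vpick_line_neq0 (L : line) :
  vpick (sval L) \in [set v : 'cV[R]_d.+1 | v != 0].
Proof.
case: L => L /= /eqP dimL; apply/mem_set => /=.
by rewrite vpick0 -dimv_eq0 dimL.
Qed.

Definition line_vec (L : line) : nzvec := exist _ (vpick (sval L)) (vpick_line_neq0 L).

Fact line_vecK : cancel line_vec line_span.
Proof.
move=> L; apply: val_inj => /=; apply/eqP; rewrite eqEdim.
rewrite -memvE memv_pick /= dim_vline.
have /set_mem /= -> := vpick_line_neq0 L.
by have /eqP -> := valP L.
Qed.

HB.instance Definition _ := isQuotient.Build nzvec line line_vecK.

(* The topology of RP^d is the quotient topology along R^{d+1} \ {0} -> RP^d,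
   v |-> <[v]>. As a [quotient_topology], RP is also a subtype of [nzvec]
   (through representatives), so [val] is not the inclusion into
   {vspace 'cV[R]_d.+1}; use [line_of]. *)
Definition RP : Type := quotient_topology line.
HB.instance Definition _ := Topological.on RP.
HB.instance Definition _ := Quotient.on RP.

Definition line_of (L : RP) : {vspace 'cV[R]_d.+1} := sval (L : line).

Lemma line_of_inj : injective line_of.
Proof. by move=> L M /(@val_inj _ _ line). Qed.

Lemma line_of_pi (v : nzvec) : line_of (\pi_RP v) = <[sval v]>%VS.
Proof. by rewrite /line_of unlock. Qed.

Definition GL : Type := {A : 'M[R]_d.+1 | A \in unitmx}.
HB.instance Definition _ := SubChoice.on GL.

Definition GL1 : GL := Sub (1%:M : 'M[R]_d.+1) (unitmx1 R d.+1).

Definition scal_rel (A B : GL) : bool :=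
  `[< exists2 c : R, c != 0 & sval B = c *: sval A >].

Fact scal_rel_refl : reflexive scal_rel.
Proof. by move=> A; apply/asboolP; exists 1; rewrite ?oner_neq0// scale1r. Qed.

Fact scal_rel_sym : symmetric scal_rel.
Proof.
suff H A B : scal_rel A B -> scal_rel B A by move=> A B; apply/idP/idP; exact: H.
move=> /asboolP[c c0 eB]; apply/asboolP; exists c^-1; rewrite ?invr_eq0//.
by rewrite eB scalerA mulVf// scale1r.
Qed.

Fact scal_rel_trans : transitive scal_rel.
Proof.
move=> B A C /asboolP[a a0 eB] /asboolP[b b0 eC].
by apply/asboolP; exists (b * a); rewrite ?mulf_neq0// eC eB scalerA.
Qed.

Canonical scal_equiv := EquivRel scal_rel scal_rel_refl scal_rel_sym scal_rel_trans.

Definition PGL : Type := {eq_quot scal_equiv}.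
HB.instance Definition _ := EqQuotient.on PGL.
HB.instance Definition _ := Choice.on PGL.

Definition PGL1 : PGL := \pi_PGL GL1.

Fact dim_GL_image (A : GL) (L : line) :
  \dim (linfun (mulmx (sval A)) @: sval L)%VS == 1%N.
Proof.
case: A => A /= uA; case: L => L /= dimL.
rewrite limg_dim_eq //; apply/eqP; rewrite (_ : lker _ = 0%VS) ?capv0//.
apply/eqP/lker0P => u v; rewrite !lfunE /= => /(congr1 (mulmx (invmx A))).
by rewrite !mulKmx.
Qed.

Definition GL_act (A : GL) (L : RP) : RP :=
  (Sub (linfun (mulmx (sval A)) @: sval (L : line))%VS (dim_GL_image A L) : line).

Definition PGL_act (g : PGL) (L : RP) : RP := GL_act (repr g) L.

Lemma line_of_GL_act A L :
  line_of (GL_act A L) = (linfun (mulmx (sval A)) @: line_of L)%VS.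
Proof. by []. Qed.

(* [PGL_act] does not depend on the choice of representatives. *)
Lemma PGL_act_pi (A : GL) (L : RP) : PGL_act (\pi_PGL A) L = GL_act A L.
Proof.
have [c c0 eA] : exists2 c : R, c != 0 & sval A = c *: sval (repr (\pi_PGL A)).
  by apply/asboolP; rewrite -/(scal_rel _ _) -[scal_rel _ _]/(scal_equiv _ _)
    -eqmodE reprK.
apply: line_of_inj; rewrite /PGL_act !line_of_GL_act.
rewrite (_ : linfun (mulmx (sval A)) =
             c *: linfun (mulmx (sval (repr (\pi_PGL A))))); last first.
  by apply/lfunP => v; rewrite scale_lfunE !lfunE /= eA scalemxAl.
apply/vspaceP => v; apply/memv_imgP/memv_imgP => -[u uL ->].
  by exists (c^-1 *: u); rewrite ?memvZ// linearZ /= scale_lfunE scalerA mulVf ?scale1r.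
by exists (c *: u); rewrite ?memvZ// scale_lfunE linearZ.
Qed.

Fact GL_mul_unit (A B : GL) : sval A *m sval B \in unitmx.
Proof. by rewrite unitmx_mul (valP A) (valP B). Qed.
Definition GL_mul (A B : GL) : GL :=
  Sub (sval A *m sval B) (GL_mul_unit A B).

Fact GL_inv_unit (A : GL) : invmx (sval A) \in unitmx.
Proof. by rewrite unitmx_inv (valP A). Qed.
Definition GL_inv (A : GL) : GL := Sub (invmx (sval A)) (GL_inv_unit A).

Lemma GL_act1 L : GL_act GL1 L = L.
Proof.
apply: line_of_inj; rewrite line_of_GL_act /=.
rewrite (_ : linfun _ = \1%VF) ?lim1g//.
by apply/lfunP => v; rewrite !lfunE /= mul1mx.
Qed.

Lemma GL_actM A B L : GL_act (GL_mul A B) L = GL_act A (GL_act B L).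
Proof.
apply: line_of_inj; rewrite !line_of_GL_act -limg_comp; congr (_ @: _)%VS.
by apply/lfunP => v; rewrite comp_lfunE !lfunE /= mulmxA.
Qed.

Lemma GL_actK A L : GL_act (GL_inv A) (GL_act A L) = L.
Proof.
rewrite -GL_actM -[RHS]GL_act1; congr GL_act.
by apply: val_inj; rewrite /= mulVmx ?(valP A).
Qed.

End ProjectiveSpace.

Section Shapes.
Variables (R : realType) (d k : nat).

Definition config : Type := {ptws 'I_k -> RP R d}.
HB.instance Definition _ := Topological.on config.

Definition config_act (g : PGL R d) (p : config) : config :=
  fun i => PGL_act g (p i).

Definition orbit_rel (p q : config) : bool :=
  `[< exists g : PGL R d, config_act g p = q >].

Fact orbit_rel_refl : reflexive orbit_rel.
Proof.
move=> p; apply/asboolP; exists (PGL1 R d); apply/funext => i.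
by rewrite /config_act PGL_act_pi GL_act1.
Qed.

Fact orbit_rel_sym : symmetric orbit_rel.
Proof.
suff H p q : orbit_rel p q -> orbit_rel q p by move=> p q; apply/idP/idP; exact: H.
move=> /asboolP[g <-]; apply/asboolP; exists (\pi_(PGL R d) (GL_inv (repr g))).
by apply/funext => i; rewrite /config_act PGL_act_pi GL_actK.
Qed.

Fact orbit_rel_trans : transitive orbit_rel.
Proof.
move=> q p r /asboolP[g <-] /asboolP[h <-]; apply/asboolP.
exists (\pi_(PGL R d) (GL_mul (repr h) (repr g))); apply/funext => i.
by rewrite /config_act PGL_act_pi GL_actM.
Qed.

Canonical orbit_equiv :=
  EquivRel orbit_rel orbit_rel_refl orbit_rel_sym orbit_rel_trans.

Definition pshape : Type := quotient_topology {eq_quot orbit_equiv}.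
HB.instance Definition _ := Topological.on pshape.
HB.instance Definition _ := Quotient.on pshape.

Definition shape_of (p : config) : pshape := \pi_pshape p.

Lemma shape_ofP (p q : config) :
  shape_of p = shape_of q <-> exists g : PGL R d, config_act g p = q.
Proof.
rewrite -[_ = _]/(\pi_{eq_quot orbit_equiv} p = \pi_{eq_quot orbit_equiv} q).
split=> [/eqP|h]; first by rewrite eqmodE => /asboolP.
by apply/eqP; rewrite eqmodE; apply/asboolP.
Qed.

Definition is_frame (q : 'I_d.+2 -> RP R d) : Prop :=
  forall I : {set 'I_d.+2}, #|I| = d.+1 ->
    (\sum_(i in I) line_of (q i))%VS = fullv.

Definition contains_frame (p : config) : Prop :=
  exists2 s : 'I_d.+2 -> 'I_k, injective s & is_frame (p \o s).

Definition isotropy (p : config) : set (PGL R d) :=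
  [set g | config_act g p = p].

Definition free_config (p : config) : Prop := isotropy p = [set PGL1 R d].

Definition frame_shapes : set pshape := shape_of @` [set p | contains_frame p].

Definition free_shapes : set pshape := shape_of @` [set p | free_config p].

End Shapes.

Arguments frame_shapes : clear implicits.
Arguments free_shapes : clear implicits.

(* Main.v *)
(** Let [e] be the last basis vector and [u] the all-ones vector. For [t != 0]
    the matrix [diag(t, ..., t, 1)] maps the configuration
      e_0, ..., e_d, u, u - e + t e, e_0, ..., e_0
    to
      e_0, ..., e_d, e + t (u - e), u, e_0, ..., e_0.
    Both contain the standard frame for every [t], but at [t = 0] the landmarks
    [d] and [d + 1] coincide in the second and not in the first. So one path of
    shapes on [t != 0] has two limits at [0].

    A configuration containing a frame is free: the [d + 2] lines of a frame
    carry vectors [u_i], all nonzero, whose sum is 0, unique up to a common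
    scalar. If a matrix preserves each line, it multiplies all the [u_i] by the
    same scalar. *)
Require Import Defs.
From mathcomp Require Import all_boot all_order all_algebra.
From mathcomp Require Import all_classical all_reals.
From mathcomp Require Import topology normedtype.

Set Implicit Arguments.
Unset Strict Implicit.
Unset Printing Implicit Defensive.

Import Order.TTheory GRing.Theory Num.Theory.
Import numFieldNormedType.Exports.

Local Open Scope classical_set_scope.
Local Open Scope ring_scope.
Local Open Scope quotient_scope.

(** Off 0 the two paths agree, so the images of the punctured neighbourhoods of 0 form one filter,
    which converges to both [f 0] and [g 0]. In a Hausdorff space limits are unique. *)
Lemma not_hausdorff_paths (R : realType) (T : topologicalType) (S : set T)
    (f g : R -> T) :
    continuous f -> continuous g ->
    (forall t, S (f t)) -> (forall t, S (g t)) ->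
    (forall t, t != 0 -> f t = g t) -> f 0 <> g 0 ->
  ~ hausdorff_space (set_type S).
Proof.
move=> cf cg Sf Sg fg fg0 hS.
pose F t : set_type S := exist _ (f t) (mem_set (Sf t)).
pose G t : set_type S := exist _ (g t) (mem_set (Sg t)).
have cF : continuous F by apply: continuous_comp_initial.
have cG : continuous G by apply: continuous_comp_initial.
apply: fg0; suff /(congr1 val) : F 0 = G 0 by [].
apply: (@cvg_unique _ hS (F @ 0^')); first exact: cvg_within_filter (cF 0).
apply: (cvg_trans (G := G @ 0^')); last exact: cvg_within_filter (cG 0).
apply: near_eq_cvg; near=> t; apply: val_inj => /=; rewrite fg//.
by near: t; exact: nbhs_dnbhs_neq.
Unshelve. all: by end_near. Qed.

(** * Linear algebra of frames, and freeness of configurations containing one *)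

Section Frames.
Variables (R : realType) (d : nat).
Implicit Types (q : 'I_d.+2 -> RP R d) (u : 'I_d.+2 -> 'cV[R]_d.+1).

Lemma dim_line_of (L : RP R d) : \dim (line_of L) = 1%N.
Proof. by rewrite /line_of; case: (L : line R d) => V /= /eqP. Qed.

Lemma frame_span q j : is_frame q -> (\sum_(i | i != j) line_of (q i))%VS = fullv.
Proof.
move=> /(_ [set~ j]%SET) <-; last by rewrite cardsC1 card_ord.
by apply: eq_bigl => i; rewrite in_setC1.
Qed.

(** The [d + 1] lines other than line [j] span a space of dimension [d + 1], so their sum is direct.
    Once [u j] vanishes, the relation involves only these lines. *)
Lemma frame_indep q j u : is_frame q -> (forall i, u i \in line_of (q i)) ->
  \sum_i u i = 0 -> u j = 0 -> forall i, u i = 0.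
Proof.
move=> qF uq su uj i; have [->//|ij] := eqVneq i j.
have : directv (\sum_(i | i != j) line_of (q i)).
  rewrite directvE /= (frame_span j qF) dimvf; apply/eqP.
  rewrite (eq_bigr (fun=> 1%N)); last by move=> l _; rewrite dim_line_of.
  by rewrite sum1_card cardC1 card_ord /dim /= muln1.
move=> /directv_sum_independent; apply => //.
by move: su; rewrite (bigD1 j)//= uj add0r.
Qed.

Lemma frame_dependency q : is_frame q ->
  exists u, [/\ forall i, u i \in line_of (q i), \sum_i u i = 0
              & forall i, u i != 0].
Proof.
move=> qF; pose x := vpick (line_of (q ord0)).
have x0 : x != 0 by rewrite vpick0 -dimv_eq0 dim_line_of.
have : x \in (\sum_(i | i != ord0) line_of (q i))%VS.
  by rewrite frame_span// memvf.
case/memv_sumP => y yq xE; pose u i := if i == ord0 then x else - y i.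
have uq i : u i \in line_of (q i).
  rewrite /u; case: eqVneq => [->|i0]; first exact: memv_pick.
  by rewrite rpredN yq.
have su : \sum_i u i = 0.
  rewrite (bigD1 ord0)//= {1}/u eqxx {1}xE -big_split/= big1// => i i0.
  by rewrite /u (negPf i0) subrr.
exists u; split => // j; apply: contraNN x0 => /eqP uj.
by have := frame_indep qF uq su uj ord0; rewrite /u eqxx => ->.
Qed.

Lemma frame_fixed_scalar q (A : 'M[R]_d.+1) : is_frame q ->
    (forall i v, v \in line_of (q i) -> A *m v \in line_of (q i)) ->
  exists c : R, A = c%:M.
Proof.
move=> qF AS; have [u [uq su u0]] := frame_dependency qF.
have qE i : line_of (q i) = <[u i]>%VS.
  by apply/esym/eqP; rewrite eqEdim -memvE uq dim_line_of dim_vline u0.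
have /vlineP[c Ac] : A *m u ord0 \in <[u ord0]>%VS by rewrite -qE AS.
(* The vectors [A *m u i - c *: u i] lie on the lines of the frame, sum to 0, and vanish at [ord0]
   by the choice of [c]; hence all of them vanish. *)
have Au : forall i, A *m u i - c *: u i = 0.
  apply: (frame_indep (j := ord0) qF) => [i||]; last by rewrite Ac subrr.
    by rewrite rpredB ?rpredZ ?AS.
  by rewrite sumrB -mulmx_sumr -scaler_sumr su mulmx0 scaler0 subrr.
exists c; suff AE (v : 'cV[R]_d.+1) : A *m v = c *: v.
  apply/matrixP => i j; have := AE (delta_mx j 0); rewrite -colE => /colP/(_ i).
  by rewrite !mxE andbT mulr_natr.
have : v \in (\sum_(i | i != ord0) line_of (q i))%VS.
  by rewrite frame_span// memvf.
case/memv_sumP => y yq ->; rewrite mulmx_sumr scaler_sumr.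
apply: eq_bigr => i /yq; rewrite qE => /vlineP[b ->].
by rewrite -scalemxAr (subr0_eq (Au i)) !scalerA mulrC.
Qed.

Lemma contains_frame_free k (p : config R d k) :
  contains_frame p -> free_config p.
Proof.
case=> s _ qF; apply/seteqP; split=> [g|g ->]; last first.
  by apply/funext => i; rewrite /config_act PGL_act_pi GL_act1.
rewrite /isotropy /= => gp.
have [c AE] : exists c : R, sval (repr g) = c%:M.
  apply: (frame_fixed_scalar qF) => i v vq.
  have /= <- := congr1 (fun p : config R d k => p (s i)) gp.
  rewrite /config_act /PGL_act line_of_GL_act.
  by apply/memv_imgP; exists v; rewrite ?lfunE.
have c0 : c != 0.
  apply: contraTneq (valP (repr g)) => c0.
  by rewrite (_ : val _ = c%:M)// c0 unitmxE det_scalar expr0n /= unitr0.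
(* The factor must carry [repr g] to the identity, hence [c^-1]. *)
rewrite -[g]reprK /PGL1; apply/eqP; rewrite eqmodE; apply/asboolP.
by exists c^-1; rewrite ?invr_eq0// AE /= scale_scalar_mx mulVf.
Qed.

Definition std_vec (i : 'I_d.+1) : 'cV[R]_d.+1 := delta_mx i 0.

Lemma std_frame q :
    (forall i : 'I_d.+1, line_of (q (inord i)) = <[std_vec i]>%VS) ->
    line_of (q ord_max) = <[const_mx 1]>%VS ->
  is_frame q.
Proof.
move=> qe qu I cI.
have memI i v : i \in I -> v \in line_of (q i) ->
    v \in (\sum_(l in I) line_of (q l))%VS.
  by move=> iI; apply/subvP; exact: (sumv_sup i).
have maxE (i : 'I_d.+1) : (inord i : 'I_d.+2) != ord_max.
  by rewrite -val_eqE /= inordK ?ltn_eqF// ltnW// ltnS.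
have inordI (i l : 'I_d.+1) : inord i = inord l :> 'I_d.+2 -> i = l.
  move=> /(congr1 val); rewrite /= !inordK ?(leqW (ltn_ord _))// => il.
  exact: val_inj.
(* A set of [d + 1] indices omits exactly one index [j]. *)
have [j jI] : exists j, I = [set~ j]%SET.
  have : #|~: I| == 1%N by rewrite cardsCs finset.setCK cI card_ord subSnn.
  by move=> /cards1P[j Ij]; exists j; rewrite -Ij finset.setCK.
have eI i : std_vec i \in (\sum_(l in I) line_of (q l))%VS.
  have [ij|ij] := eqVneq (inord i) j; last first.
    by apply: (memI (inord i)); rewrite ?jI ?in_setC1// qe memv_line.
  (* When the omitted line is that of a basis vector, this vector is recovered from the all-ones
     vector and the remaining basis vectors. *)
  have -> : std_vec i = const_mx 1 - \sum_(l | l != i) std_vec l.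
    apply/colP => m; rewrite !mxE summxE; under eq_bigr do rewrite mxE andbT.
    have [->|mi] := eqVneq m i.
      by rewrite big1 ?subr0// => l /negPf; rewrite eq_sym => ->.
    rewrite (bigD1 m)//= eqxx big1 ?addr0 ?subrr// => l /andP[_ /negPf].
    by rewrite eq_sym => ->.
  apply: rpredB; last apply: rpred_sum => l li.
    by apply: (memI ord_max); rewrite ?qu ?memv_line// jI in_setC1 -ij eq_sym.
  apply: (memI (inord l)); rewrite ?qe ?memv_line// jI in_setC1 -ij.
  by apply: contraNneq li => /inordI ->.
apply/vspaceP => v; rewrite memvf.
rewrite (matrix_sum_delta v); apply: rpred_sum => i _; apply: rpred_sum => l _.
by rewrite rpredZ// (ord1 l) eI.
Qed.

End Frames.

(** * Continuity of paths of shapes given by paths of vectors *)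

Section Paths.
Variables (R : realType) (d k : nat).

Definition nonzero_vec (v : 'cV[R]_d.+1) (v0 : v != 0) : nzvec R d :=
  exist _ v (mem_set v0).

Definition config_of (f : 'I_k -> 'cV[R]_d.+1) (f0 : forall i, f i != 0) :
  config R d k := fun i => \pi_(RP R d) (nonzero_vec (f0 i)).

Lemma shape_path_continuous (f : R -> 'I_k -> 'cV[R]_d.+1)
    (f0 : forall t i, f t i != 0) :
    (forall i, continuous (f^~ i)) ->
  continuous (fun t => shape_of (config_of (f0 t))).
Proof.
move=> cf.
have cp : continuous (fun t => config_of (f0 t) : config R d k).
  (* The topology on configurations is the supremum of those induced by the evaluations, so
     continuity is checked landmark by landmark. *)
  move=> t; apply/cvg_sup => i; move: t.
  apply: (@continuous_comp_initial _ _ _ (fun p : 'I_k -> RP R d => p i)) => t.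
  have cv : continuous (fun t => nonzero_vec (f0 t i)).
    by apply: continuous_comp_initial; exact: cf.
  apply: (@cvg_comp _ _ _ (fun t => nonzero_vec (f0 t i)) _ _ _ _ (cv t)).
  exact: (@pi_continuous (nzvec R d) (line R d)).
move=> t; apply: (@cvg_comp _ _ _ _ _ _ _ _ (cp t)).
exact: (@pi_continuous (config R d k) {eq_quot orbit_equiv R d k}).
Qed.

End Paths.

(** * The two paths, their common shapes off 0 and their distinct limits *)

Section Counterexample.
Variables (R : realType) (d k : nat).
Hypotheses (hd : (1 <= d)%N) (hk : (d + 3 <= k)%N).

Let e : 'cV[R]_d.+1 := std_vec R ord_max.
Let u : 'cV[R]_d.+1 := const_mx 1.

Definition path1 (t : R) (i : 'I_k) : 'cV[R]_d.+1 :=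
  if (i <= d)%N then std_vec R (inord i) else if i == d.+1 :> nat then u
  else if i == d.+2 :> nat then u - e + t *: e else std_vec R ord0.

Definition path2 (t : R) (i : 'I_k) : 'cV[R]_d.+1 :=
  if (i <= d)%N then std_vec R (inord i)
  else if i == d.+1 :> nat then e + t *: (u - e)
  else if i == d.+2 :> nat then u else std_vec R ord0.

Lemma std_vec_neq0 i : std_vec R i != 0 :> 'cV[R]_d.+1.
Proof.
by apply/eqP => /colP/(_ i)/eqP; rewrite !mxE !eqxx oner_eq0.
Qed.

Lemma const1_neq0 : u != 0.
Proof. by apply/eqP => /colP/(_ ord0)/eqP; rewrite !mxE oner_eq0. Qed.

Lemma ord0_neq_max : (ord0 == ord_max :> 'I_d.+1) = false.
Proof. by rewrite -val_eqE /= ltn_eqF. Qed.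

Lemma path1_neq0 t i : path1 t i != 0.
Proof.
rewrite /path1; do 3?[case: ifP => _]; rewrite ?std_vec_neq0 ?const1_neq0//.
(* Coordinate 0 of [u - e + t *: e] is 1 for every [t], since [d >= 1] makes it differ from the last
   one. *)
apply/eqP => /colP/(_ ord0)/eqP.
by rewrite !mxE ord0_neq_max mulr0 subr0 addr0 oner_eq0.
Qed.

Lemma path2_neq0 t i : path2 t i != 0.
Proof.
rewrite /path2; do 3?[case: ifP => _]; rewrite ?std_vec_neq0 ?const1_neq0//.
(* The last coordinate of [e + t *: (u - e)] is 1 for every [t]. *)
apply/eqP => /colP/(_ ord_max)/eqP.
by rewrite !mxE !eqxx subrr mulr0 addr0 oner_eq0.
Qed.

Lemma affine_continuous (a b : 'cV[R]_d.+1) :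
  continuous (fun t : R => a + t *: b).
Proof.
by move=> t; apply: cvgD; [exact: cvg_cst|apply: cvgZr_tmp; exact: cvg_id].
Qed.

Lemma path1_continuous i : continuous (path1^~ i).
Proof.
rewrite /path1; case: (i <= d)%N; first exact: cst_continuous.
case: (_ == d.+1); first exact: cst_continuous.
by case: (_ == d.+2); [exact: affine_continuous|exact: cst_continuous].
Qed.

Lemma path2_continuous i : continuous (path2^~ i).
Proof.
rewrite /path2; case: (i <= d)%N; first exact: cst_continuous.
case: (_ == d.+1); first exact: affine_continuous.
by case: (_ == d.+2); exact: cst_continuous.
Qed.

Let conf1 t := config_of (path1_neq0 t).
Let conf2 t := config_of (path2_neq0 t).

Lemma line_of_config (f : 'I_k -> 'cV[R]_d.+1) (f0 : forall i, f i != 0) i :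
  line_of (config_of f0 i) = <[f i]>%VS.
Proof. exact: line_of_pi. Qed.

Lemma conf1_frame t : contains_frame (conf1 t).
Proof.
have dk : (d.+2 <= k)%N by apply: leq_trans hk; rewrite addn3.
exists (widen_ord dk).
  by move=> i j /(congr1 val) /= ij; exact: val_inj.
apply: std_frame => [i|]; rewrite /= line_of_config /path1 /=.
  by rewrite inordK ?(leqW (ltn_ord _))// leq_ord inord_val.
by rewrite ltnn eqxx.
Qed.

Lemma conf2_frame t : contains_frame (conf2 t).
Proof.
(* The frame skips the moving landmark [d + 1]: its last point is landmark [d + 2], which exists
   because [d + 3 <= k]. *)
have sk (i : 'I_d.+2) : ((if (i <= d)%N then i : nat else d.+2) < k)%N.
  apply: leq_trans hk; rewrite addn3 ltnS; case: ifP => // id.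
  exact: leqW (leqW id).
exists (fun i => Ordinal (sk i)).
  move=> i j /(congr1 val) /=; case: leqP => id; case: leqP => jd // ij.
  - exact: val_inj.
  - by move: id; rewrite ij ltnNge leqnSn.
  - by move: jd; rewrite -ij ltnNge leqnSn.
  - apply: val_inj => /=; apply/eqP; rewrite eqn_leq.
    by rewrite (leq_trans _ jd) ?(leq_trans _ id)// -ltnS ltn_ord.
apply: std_frame => [i|]; rewrite /= line_of_config /path2 /=.
  by rewrite inordK ?(leqW (ltn_ord _))// !leq_ord inord_val.
by rewrite ltnn /= !ltnNge leqnSn /= eqxx gtn_eqF.
Qed.

Lemma GL_act_line (A : GL R d) (L : RP R d) v :
  line_of L = <[v]>%VS -> line_of (GL_act A L) = <[sval A *m v]>%VS.
Proof. by move=> Lv; rewrite line_of_GL_act Lv limg_line lfunE. Qed.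

Lemma shape_conf12 t : t != 0 -> shape_of (conf1 t) = shape_of (conf2 t).
Proof.
move=> t0; pose D : 'rV[R]_d.+1 := \row_j (if j == ord_max then 1 else t).
have uD : diag_mx D \in unitmx.
  rewrite unitmxE det_diag unitfE; apply/prodf_neq0 => i _; rewrite mxE.
  by case: ifP; rewrite ?oner_eq0.
have De i : diag_mx D *m std_vec R i = D 0 i *: std_vec R i.
  apply/colP => j; rewrite mul_diag_mx !mxE.
  by have [->|] := eqVneq j i; rewrite ?mulr0.
have D0 i : D 0 i != 0 by rewrite mxE; case: ifP; rewrite ?oner_eq0.
have Du : diag_mx D *m u = e + t *: (u - e).
  apply/colP => j; rewrite mul_diag_mx !mxE andbT.
  by case: eqVneq => _; rewrite ?subrr ?mulr0 ?addr0 ?subr0 ?add0r ?mulr1.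
(* The entries 1 before the last are multiplied by [t], and the last entry [t] is kept: a nonzero
   multiple of [u], hence the same line. *)
have Dw : diag_mx D *m (u - e + t *: e) = t *: u.
  apply/colP => j; rewrite mul_diag_mx !mxE andbT.
  by case: eqVneq => _; rewrite ?subrr ?mulr0 ?addr0 ?subr0 ?add0r ?mulr1 ?mul1r.
have lineZ (c : R) (v : 'cV[R]_d.+1) : c != 0 -> (<[c *: v]> = <[v]>)%VS.
  move=> c0; apply/eqP; rewrite eqEsubv -!memvE memvZ ?memv_line//=.
  by rewrite -[v in v \in _](scalerK c0) memvZ// memv_line.
apply/shape_ofP; exists (\pi_(PGL R d) (Sub (diag_mx D) uD)).
apply/funext => i; apply: line_of_inj.
rewrite /config_act PGL_act_pi (GL_act_line _ (line_of_config _ i)).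
rewrite line_of_config /= /path1 /path2.
by do 3?[case: ifP => _]; rewrite ?De ?Du ?Dw ?lineZ.
Qed.

(** Coincidence of two landmarks is invariant under the group, so it can be pulled back along [g]
    from the second configuration to the first. *)
Lemma shape_conf12_0 : shape_of (conf1 0) <> shape_of (conf2 0).
Proof.
move=> /shape_ofP[g gE].
have dk : (d < k)%N by apply: leq_trans hk; rewrite addn3 leqW.
have dk1 : (d.+1 < k)%N by apply: leq_trans hk; rewrite addn3.
have : conf2 0 (Ordinal dk) = conf2 0 (Ordinal dk1).
  apply: line_of_inj; rewrite !line_of_config /path2 /= leqnn ltnn eqxx.
  by rewrite scale0r addr0; congr (<[std_vec R _]>%VS); apply: val_inj;
    rewrite /= inordK.
rewrite -gE /config_act /PGL_act => /(congr1 (GL_act (GL_inv (repr g)))).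
rewrite !GL_actK => /(congr1 (@line_of R d)).
rewrite !line_of_config /path1 /= leqnn ltnn eqxx => ue.
have : u \in <[std_vec R (inord d)]>%VS by rewrite ue memv_line.
(* Coordinate 0 is 1 in [u] and 0 in the last basis vector, as [d >= 1]. *)
case/vlineP => c /colP/(_ ord0)/eqP; rewrite !mxE -val_eqE /= inordK// ltn_eqF//.
by rewrite mulr0 oner_eq0.
Qed.

(** Both paths stay among the shapes containing a frame, so any larger set of shapes inherits the
    failure; this covers both spaces at once. *)
Lemma frame_shapes_sub_not_hausdorff (S : set (pshape R d k)) :
  frame_shapes R d k `<=` S -> ~ hausdorff_space (set_type S).
Proof.
move=> FS.
apply: (@not_hausdorff_paths R (pshape R d k) S
  (fun t => shape_of (conf1 t)) (fun t => shape_of (conf2 t))).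
- exact/shape_path_continuous/path1_continuous.
- exact/shape_path_continuous/path2_continuous.
- by move=> t; apply: FS; exists (conf1 t) => //; exact: conf1_frame.
- by move=> t; apply: FS; exists (conf2 t) => //; exact: conf2_frame.
- exact: shape_conf12.
- exact: shape_conf12_0.
Qed.

End Counterexample.

Theorem mainTheorem5 (R : realType) (d k : nat) (hd : (1 <= d)%N)
    (hk : (d + 3 <= k)%N) :
  ~ hausdorff_space (set_type (frame_shapes R d k)) /\
  frame_shapes R d k `<=` free_shapes R d k /\
  ~ hausdorff_space (set_type (free_shapes R d k)).
Proof.
have Ffree : frame_shapes R d k `<=` free_shapes R d k.
  by move=> _ [p pF <-]; exists p => //; exact: contains_frame_free.
by split; [|split=> //]; exact: frame_shapes_sub_not_hausdorff.
Qed.
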